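(* Let $\bar x\in\mathbb{R}^n$ be a feasible point of (MPCC) or of (MPVC); in each case, all stationarity notions below are those of the respective problem. (a) If $\bar x$ is $P_\alpha$-stationary for some $\alpha\in\{0,1\}^p$, then it is $A_\alpha$-stationary. (b) The point $\bar x$ is A-stationary if and only if there exists some $\alpha\in\{0,1\}^p$ such that $\bar x$ is $A_\alpha$-stationary. (c) The point $\bar x$ is C-stationary if and only if there exists some $d\in[0,1]^p$ such that $\bar x$ is $P_d$-stationary. (d) The point $\bar x$ is M-stationary if and only if there exists some $\alpha\in\{0,1\}^p$ such that $\bar x$ is $P_\alpha$-stationary. (e) In the case of (MPVC), $A_0$-stationarity is the same as $P_0$-stationarity (where $0$ denotes the zero vector $\alpha=0\in\{0,1\}^p$).
   Context: Let $f:\mathbb{R}^n\to\mathbb{R}$, $g:\mathbb{R}^n\to\mathbb{R}^l$, $h:\mathbb{R}^n\to\mathbb{R}^m$, $G,H:\mathbb{R}^n\to\mathbb{R}^p$ be differentiable functions. Problem (MPCC): minimize $f(x)$ over $x\in\mathbb{R}^n$ subject to $g(x)\le 0$, $h(x)=0$, $G(x)\ge 0$, $H(x)\ge 0$, $G(x)^\top H(x)=0$. Problem (MPVC): minimize $f(x)$ over $x\in\mathbb{R}^n$ subject to $g(x)\le 0$, $h(x)=0$, and $H_i(x)\ge 0$, $G_i(x)H_i(x)\le 0$ for all $i\in\{1,\dots,p\}$. Index sets: $I^l=\{1,\dots,l\}$, $I^m=\{1,\dots,m\}$, $I^p=\{1,\dots,p\}$, $I^g(x)=\{i\in I^l: g_i(x)=0\}$,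 and, as subsets of $I^p$, $I^{+0}(x)=\{G_i(x)>0, H_i(x)=0\}$, $I^{0+}(x)=\{G_i(x)=0, H_i(x)>0\}$, $I^{-0}(x)=\{G_i(x)<0, H_i(x)=0\}$, $I^{-+}(x)=\{G_i(x)<0, H_i(x)>0\}$, $I^{00}(x)=\{G_i(x)=0, H_i(x)=0\}$; for $\alpha\in\{0,1\}^p$ and $c\in\{0,1\}$, $I^{00}_{\alpha=c}(x)=\{i\in I^{00}(x): \alpha_i=c\}$. Stationarity notions for (MPCC). Multipliers $\bar\lambda\in\mathbb{R}^l$, $\bar\eta\in\mathbb{R}^m$, $\bar\mu,\bar\nu\in\mathbb{R}^p$ satisfy the system of weak stationarity at a feasible point $\bar x$ of (MPCC) if $$\nabla f(\bar x)+\sum_{i\in I^l}\bar\lambda_i\nabla g_i(\bar x)+\sum_{i\in I^m}\bar\eta_i\nabla h_i(\bar x)-\sum_{i\in I^p}\bar\mu_i\nabla G_i(\bar x)-\sum_{i\in I^p}\bar\nu_i\nabla H_i(\bar x)=0,$$ $\bar\lambda_i\ge 0$ for $i\in I^g(\bar x)$, $\bar\lambda_i=0$ for $i\in I^l\setminus I^g(\bar x)$, $\bar\mu_i=0$ for $i\in I^{+0}(\bar x)$, $\bar\nu_i=0$ for $i\in I^{0+}(\bar x)$. The point $\bar x$ is called stationary in one of the following senses if there exist multipliers satisfying the system of weak stationarity and the indicated additional condition: - A-stationary: $\bar\mu_i\ge 0\vee\bar\nu_i\ge 0$ for all $i\in I^{00}(\bar x)$; - C-stationary: $\bar\mu_i\bar\nu_i\ge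 0$ for all $i\in I^{00}(\bar x)$; - M-stationary: $(\bar\mu_i\ge 0\wedge\bar\nu_i\ge 0)\vee\bar\mu_i\bar\nu_i=0$ for all $i\in I^{00}(\bar x)$; - $A_\alpha$-stationary ($\alpha\in\{0,1\}^p$): $\bar\mu_i\ge 0$ for all $i\in I^{00}_{\alpha=0}(\bar x)$ and $\bar\nu_i\ge 0$ for all $i\in I^{00}_{\alpha=1}(\bar x)$; - $P_\alpha$-stationary ($\alpha\in\{0,1\}^p$): $(\bar\mu_i\ge 0\wedge\bar\nu_i\ge 0)\vee\bar\mu_i=0$ for all $i\in I^{00}_{\alpha=0}(\bar x)$ and $(\bar\mu_i\ge 0\wedge\bar\nu_i\ge 0)\vee\bar\nu_i=0$ for all $i\in I^{00}_{\alpha=1}(\bar x)$; - $P_d$-stationary ($d\in[0,1]^p$): $(\bar\mu_i\ge 0\wedge\bar\nu_i\ge 0)\vee(1-d_i)\bar\mu_i=d_i\bar\nu_i$ for all $i\in I^{00}(\bar x)$. Stationarity notions for (MPVC). Multipliers $\bar\lambda\in\mathbb{R}^l$, $\bar\eta\in\mathbb{R}^m$, $\bar\mu,\bar\nu\in\mathbb{R}^p$ satisfy the system of weak stationarity at a feasible point $\bar x$ of (MPVC) if $$\nabla f(\bar x)+\sum_{i\in I^l}\bar\lambda_i\nabla g_i(\bar x)+\sum_{i\in I^m}\bar\eta_i\nabla h_i(\bar x)+\sum_{i\in I^p}\bar\mu_i\nabla G_i(\bar x)-\sum_{i\in I^p}\bar\nu_i\nabla H_i(\bar x)=0,$$ $\bar\lambda_i\ge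 0$ for $i\in I^g(\bar x)$, $\bar\lambda_i=0$ for $i\in I^l\setminus I^g(\bar x)$, $\bar\mu_i=0$ for $i\in I^{+0}(\bar x)\cup I^{-0}(\bar x)\cup I^{-+}(\bar x)$, $\bar\mu_i\ge 0$ for $i\in I^{0+}(\bar x)\cup I^{00}(\bar x)$, $\bar\nu_i=0$ for $i\in I^{0+}(\bar x)\cup I^{-+}(\bar x)$, $\bar\nu_i\ge 0$ for $i\in I^{-0}(\bar x)$. The point $\bar x$ is called stationary in one of the following senses if there exist multipliers satisfying this system and the indicated additional condition: - A-stationary: $\bar\mu_i=0\vee\bar\nu_i\ge 0$ for all $i\in I^{00}(\bar x)$; - C-stationary (also called T-stationary): $\bar\mu_i\bar\nu_i\le 0$ for all $i\in I^{00}(\bar x)$; - M-stationary: $\bar\mu_i\bar\nu_i=0$ for all $i\in I^{00}(\bar x)$; - $A_\alpha$-stationary ($\alpha\in\{0,1\}^p$): $\bar\mu_i=0$ for all $i\in I^{00}_{\alpha=0}(\bar x)$ and $\bar\nu_i\ge 0$ for all $i\in I^{00}_{\alpha=1}(\bar x)$; - $P_\alpha$-stationary ($\alpha\in\{0,1\}^p$): $\bar\mu_i=0$ for all $i\in I^{00}_{\alpha=0}(\bar x)$ and $(\bar\mu_i=0\wedge\bar\nu_i\ge 0)\vee\bar\nu_i=0$ for all $i\in I^{00}_{\alpha=1}(\bar x)$; - $P_d$-stationary ($d\in[0,1]^p$): $(\bar\mu_i=0\wedge\bar\nu_i\ge 0)\vee(1-d_i)\bar\mu_i=-d_i\bar\nu_i$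 for all $i\in I^{00}(\bar x)$. *)

(* Defs.v *)
From HB Require Import structures.
From mathcomp Require Import all_boot all_order all_algebra.
From mathcomp Require Import all_classical all_reals all_analysis.

Set Implicit Arguments.
Unset Strict Implicit.
Unset Printing Implicit Defensive.

Import Order.TTheory GRing.Theory Num.Theory.
Import numFieldNormedType.Exports.

Local Open Scope ring_scope.

(* The row of partial derivatives; it represents 'd f x when f is
   differentiable at x. *)
Definition gradient (R : realType) (n : nat) (f : 'rV[R]_n -> R)
    (x : 'rV[R]_n) : 'rV[R]_n :=
  \row_j 'D_(delta_mx 0 j) f x.

Section Problems.

Variables (R : realType) (n l m p : nat).
Variables (f : 'rV[R]_n -> R) (g : 'rV[R]_n -> 'rV[R]_l)
          (h : 'rV[R]_n -> 'rV[R]_m) (G H : 'rV[R]_n -> 'rV[R]_p).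
Variable x : 'rV[R]_n.

Definition MPCC_feasible : Prop :=
  [/\ forall i, g x 0 i <= 0,
      h x = 0,
      forall i, 0 <= G x 0 i,
      forall i, 0 <= H x 0 i
    & G x *m (H x)^T = 0].

Definition MPVC_feasible : Prop :=
  [/\ forall i, g x 0 i <= 0,
      h x = 0,
      forall i, 0 <= H x 0 i
    & forall i, G x 0 i * H x 0 i <= 0].

(* In the names of the index sets, the first letter is the sign of G_i(x), the
   second that of H_i(x): p = positive, m = negative, 0 = zero. *)
Definition Ig : {set 'I_l} := [set i | g x 0 i == 0].
Definition Ip0 : {set 'I_p} := [set i | (0 < G x 0 i) && (H x 0 i == 0)].
Definition I0p : {set 'I_p} := [set i | (G x 0 i == 0) && (0 < H x 0 i)].
Definition Im0 : {set 'I_p} := [set i | (G x 0 i < 0) && (H x 0 i == 0)].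
Definition Imp : {set 'I_p} := [set i | (G x 0 i < 0) && (0 < H x 0 i)].
Definition I00 : {set 'I_p} := [set i | (G x 0 i == 0) && (H x 0 i == 0)].

(* Vectors of {0,1}^p are boolean: false stands for 0, true for 1. *)
Definition I00_ (alpha : {ffun 'I_p -> bool}) (c : bool) : {set 'I_p} :=
  [set i in I00 | alpha i == c].

Definition MPCC_weak (la : 'rV[R]_l) (eta : 'rV[R]_m) (mu nu : 'rV[R]_p)
    : Prop :=
  [/\ gradient f x
        + \sum_i la 0 i *: gradient (fun y => g y 0 i) x
        + \sum_i eta 0 i *: gradient (fun y => h y 0 i) x
        - \sum_i mu 0 i *: gradient (fun y => G y 0 i) x
        - \sum_i nu 0 i *: gradient (fun y => H y 0 i) x = 0,
      forall i, i \in Ig -> 0 <= la 0 i,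
      forall i, i \notin Ig -> la 0 i = 0,
      forall i, i \in Ip0 -> mu 0 i = 0
    & forall i, i \in I0p -> nu 0 i = 0].

Definition MPCC_A_stationary : Prop :=
  exists la eta mu nu, MPCC_weak la eta mu nu /\
    forall i, i \in I00 -> 0 <= mu 0 i \/ 0 <= nu 0 i.

Definition MPCC_C_stationary : Prop :=
  exists la eta mu nu, MPCC_weak la eta mu nu /\
    forall i, i \in I00 -> 0 <= mu 0 i * nu 0 i.

Definition MPCC_M_stationary : Prop :=
  exists la eta mu nu, MPCC_weak la eta mu nu /\
    forall i, i \in I00 ->
      (0 <= mu 0 i /\ 0 <= nu 0 i) \/ mu 0 i * nu 0 i = 0.

Definition MPCC_Aalpha_stationary (alpha : {ffun 'I_p -> bool}) : Prop :=
  exists la eta mu nu, [/\ MPCC_weak la eta mu nu,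
    forall i, i \in I00_ alpha false -> 0 <= mu 0 i
  & forall i, i \in I00_ alpha true -> 0 <= nu 0 i].

Definition MPCC_Palpha_stationary (alpha : {ffun 'I_p -> bool}) : Prop :=
  exists la eta mu nu, [/\ MPCC_weak la eta mu nu,
    forall i, i \in I00_ alpha false ->
      (0 <= mu 0 i /\ 0 <= nu 0 i) \/ mu 0 i = 0
  & forall i, i \in I00_ alpha true ->
      (0 <= mu 0 i /\ 0 <= nu 0 i) \/ nu 0 i = 0].

Definition MPCC_Pd_stationary (d : 'rV[R]_p) : Prop :=
  exists la eta mu nu, MPCC_weak la eta mu nu /\
    forall i, i \in I00 ->
      (0 <= mu 0 i /\ 0 <= nu 0 i) \/ (1 - d 0 i) * mu 0 i = d 0 i * nu 0 i.

Definition MPVC_weak (la : 'rV[R]_l) (eta : 'rV[R]_m) (mu nu : 'rV[R]_p)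
    : Prop :=
  [/\ gradient f x
        + \sum_i la 0 i *: gradient (fun y => g y 0 i) x
        + \sum_i eta 0 i *: gradient (fun y => h y 0 i) x
        + \sum_i mu 0 i *: gradient (fun y => G y 0 i) x
        - \sum_i nu 0 i *: gradient (fun y => H y 0 i) x = 0,
      (forall i, i \in Ig -> 0 <= la 0 i) /\
      (forall i, i \notin Ig -> la 0 i = 0),
      (forall i, i \in Ip0 :|: Im0 :|: Imp -> mu 0 i = 0) /\
      (forall i, i \in I0p :|: I00 -> 0 <= mu 0 i),
      forall i, i \in I0p :|: Imp -> nu 0 i = 0
    & forall i, i \in Im0 -> 0 <= nu 0 i].

Definition MPVC_A_stationary : Prop :=
  exists la eta mu nu, MPVC_weak la eta mu nu /\
    forall i, i \in I00 -> mu 0 i = 0 \/ 0 <= nu 0 i.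

Definition MPVC_C_stationary : Prop :=
  exists la eta mu nu, MPVC_weak la eta mu nu /\
    forall i, i \in I00 -> mu 0 i * nu 0 i <= 0.

Definition MPVC_M_stationary : Prop :=
  exists la eta mu nu, MPVC_weak la eta mu nu /\
    forall i, i \in I00 -> mu 0 i * nu 0 i = 0.

Definition MPVC_Aalpha_stationary (alpha : {ffun 'I_p -> bool}) : Prop :=
  exists la eta mu nu, [/\ MPVC_weak la eta mu nu,
    forall i, i \in I00_ alpha false -> mu 0 i = 0
  & forall i, i \in I00_ alpha true -> 0 <= nu 0 i].

Definition MPVC_Palpha_stationary (alpha : {ffun 'I_p -> bool}) : Prop :=
  exists la eta mu nu, [/\ MPVC_weak la eta mu nu,
    forall i, i \in I00_ alpha false -> mu 0 i = 0
  & forall i, i \in I00_ alpha true ->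
      (mu 0 i = 0 /\ 0 <= nu 0 i) \/ nu 0 i = 0].

Definition MPVC_Pd_stationary (d : 'rV[R]_p) : Prop :=
  exists la eta mu nu, MPVC_weak la eta mu nu /\
    forall i, i \in I00 ->
      (mu 0 i = 0 /\ 0 <= nu 0 i)
      \/ (1 - d 0 i) * mu 0 i = - d 0 i * nu 0 i.

End Problems.

(* Main.v *)
Require Import Defs.
From HB Require Import structures.
From mathcomp Require Import all_boot all_order all_algebra.
From mathcomp Require Import all_classical all_reals all_analysis.
From mathcomp Require Import ring lra.

Import Order.TTheory GRing.Theory Num.Theory.
Import numFieldNormedType.Exports.

Local Open Scope ring_scope.

(* The same multipliers serve on both sides of every implication. In (b) and
   (d), alpha records, for each biactive index, which alternative of a
   disjunction holds. For (c), [0 <= a * b] if and only if some d in [0, 1]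
   satisfies [(1 - d) * a = d * b], with witness [d = a / (a + b)]; this is
   applied to (mu, nu) for MPCC and to (mu, - nu) for MPVC. *)

Lemma I00_disjunctionP {R : realType} {n p : nat} {G H : 'rV[R]_n -> 'rV[R]_p}
    {x : 'rV[R]_n} {Q0 Q1 : 'I_p -> Prop} :
  (forall i, i \in I00 G H x -> Q0 i \/ Q1 i) <->
  exists alpha : {ffun 'I_p -> bool},
    (forall i, i \in I00_ G H x alpha false -> Q0 i) /\
    (forall i, i \in I00_ G H x alpha true -> Q1 i).
Proof.
split=> [Q|[alpha [Q0f Q1t]] i i00].
  (* By excluded middle, [alpha i] can be set to true exactly when [Q0 i] fails; on the true block
     only [Q1 i] then remains. *)
  exists [ffun i => ~~ `[< Q0 i >]].
  split=> i; rewrite inE ffunE => /andP[i00].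
    by rewrite eqbF_neg negbK => /asboolP.
  by rewrite eqb_id => /asboolP nQ0; case: (Q i i00).
case: (boolP (alpha i)) => ai; [right; apply: Q1t | left; apply: Q0f].
  by rewrite inE i00 ai.
by rewrite inE i00 (negbTE ai).
Qed.

(* If [a + b = 0] then [a = b = 0], and the weight is the junk value [0]. *)
Lemma mulr_ge0_weight {R : realFieldType} {a b : R} :
  0 <= a * b ->
  0 <= a / (a + b) <= 1 /\ (1 - a / (a + b)) * a = a / (a + b) * b.
Proof.
have [ab0 ab_ge0|abN0] := eqVneq (a + b) 0.
  have b_a : b = - a by apply/eqP; rewrite -addr_eq0 addrC ab0.
  (* With [b = - a], the hypothesis [0 <= a * b] says that [- a ^+ 2] is nonnegative. *)
  have a0 : a = 0.
    apply/eqP; rewrite -sqrf_eq0 eq_le sqr_ge0 andbT.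
    by rewrite -oppr_ge0 expr2 -mulrN -b_a.
  by rewrite b_a a0 oppr0 !mul0r !mulr0 lexx ler01.
move=> ab_ge0; split; last by field.
(* The sign of [a + b] is unknown, so the fraction is expanded to the positive denominator
   [(a + b) ^+ 2]. The upper bound 1 then amounts to [0 <= a * b + b ^+ 2]. *)
have s_gt0 : 0 < (a + b) ^+ 2 by rewrite exprn_even_gt0.
have -> : a / (a + b) = (a ^+ 2 + a * b) / (a + b) ^+ 2 by field.
rewrite divr_ge0 ?sqr_ge0 ?addr_ge0 ?sqr_ge0 //= ler_pdivrMr // mul1r.
by have := sqr_ge0 b; lra.
Qed.

(** For [d = 0] the equation gives [a = 0]; for [d > 0], multiplying the product by [d] gives
    [d * (a * b) = (1 - d) * a ^+ 2], which is nonnegative. *)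
Lemma weight_mulr_ge0 {R : realFieldType} {d a b : R} :
  0 <= d <= 1 -> (1 - d) * a = d * b -> 0 <= a * b.
Proof.
move=> /andP[d0 d1] dab.
have [d_0|dN0] := eqVneq d 0.
  by move: dab; rewrite d_0 subr0 mul1r mul0r => ->; rewrite mul0r.
have d_gt0 : 0 < d by rewrite lt_neqAle eq_sym dN0.
rewrite -(pmulr_rge0 _ d_gt0) mulrCA -dab mulrCA -expr2.
by rewrite mulr_ge0 ?sqr_ge0 // subr_ge0.
Qed.

Theorem corollary2p7 (R : realType) (n l m p : nat)
    (f : 'rV[R]_n -> R) (g : 'rV[R]_n -> 'rV[R]_l)
    (h : 'rV[R]_n -> 'rV[R]_m) (G H : 'rV[R]_n -> 'rV[R]_p)
    (df : forall y, differentiable f y) (dg : forall y, differentiable g y)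
    (dh : forall y, differentiable h y) (dG : forall y, differentiable G y)
    (dH : forall y, differentiable H y)
    (x : 'rV[R]_n) :
  (MPCC_feasible g h G H x ->
    [/\ forall alpha : {ffun 'I_p -> bool},
          MPCC_Palpha_stationary f g h G H x alpha ->
          MPCC_Aalpha_stationary f g h G H x alpha,
        MPCC_A_stationary f g h G H x <->
          exists alpha : {ffun 'I_p -> bool},
            MPCC_Aalpha_stationary f g h G H x alpha,
        MPCC_C_stationary f g h G H x <->
          exists d : 'rV[R]_p, (forall i, 0 <= d 0 i <= 1) /\
            MPCC_Pd_stationary f g h G H x d
      & MPCC_M_stationary f g h G H x <->
          exists alpha : {ffun 'I_p -> bool},
            MPCC_Palpha_stationary f g h G H x alpha]) /\
  (MPVC_feasible g h G H x ->
    [/\ forall alpha : {ffun 'I_p -> bool},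
          MPVC_Palpha_stationary f g h G H x alpha ->
          MPVC_Aalpha_stationary f g h G H x alpha,
        MPVC_A_stationary f g h G H x <->
          exists alpha : {ffun 'I_p -> bool},
            MPVC_Aalpha_stationary f g h G H x alpha,
        MPVC_C_stationary f g h G H x <->
          exists d : 'rV[R]_p, (forall i, 0 <= d 0 i <= 1) /\
            MPVC_Pd_stationary f g h G H x d,
        MPVC_M_stationary f g h G H x <->
          exists alpha : {ffun 'I_p -> bool},
            MPVC_Palpha_stationary f g h G H x alpha
      & MPVC_Aalpha_stationary f g h G H x [ffun=> false] <->
          MPVC_Palpha_stationary f g h G H x [ffun=> false]]).
Proof.
split=> _; split.
- move=> alpha [la [eta [mu [nu [W Pf Pt]]]]]; exists la, eta, mu, nu.
  by split=> // i => [/Pf|/Pt] [[]|->].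
- split=> [[la [eta [mu [nu [W]]]]]|[alpha [la [eta [mu [nu [W Af At]]]]]]].
    by move=> /I00_disjunctionP[alpha [Af At]]; exists alpha, la, eta, mu, nu.
  exists la, eta, mu, nu; split=> //.
  by apply/I00_disjunctionP; exists alpha.
- split=> [[la [eta [mu [nu [W C]]]]]|[d [d01 [la [eta [mu [nu [W P]]]]]]]].
    (* Outside I00 the sign of [mu_i * nu_i] is unknown, hence the guard. *)
    exists (\row_i if i \in I00 G H x then mu 0 i / (mu 0 i + nu 0 i) else 0).
    split=> [i|].
      rewrite mxE; case: ifP => [/C/mulr_ge0_weight[]//|_].
      by rewrite lexx ler01.
    exists la, eta, mu, nu; split=> // i i00; right.
    by rewrite mxE i00; have [] := mulr_ge0_weight (C i i00).
  exists la, eta, mu, nu; split=> // i /P[[mu0 nu0]|]; first exact: mulr_ge0.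
  exact: weight_mulr_ge0.
- split=> [[la [eta [mu [nu [W M]]]]]|[alpha [la [eta [mu [nu [W Pf Pt]]]]]]].
    (* The M-condition is recast as a disjunction of the two block conditions. The sign alternative
       belongs to both and is assigned to the first; a zero product is split by its vanishing
       factor. *)
    have /I00_disjunctionP[alpha [Pf Pt]] : forall i, i \in I00 G H x ->
        ((0 <= mu 0 i /\ 0 <= nu 0 i) \/ mu 0 i = 0) \/
        ((0 <= mu 0 i /\ 0 <= nu 0 i) \/ nu 0 i = 0).
      move=> i /M[|/eqP]; first by left; left.
      by rewrite mulf_eq0 => /orP[]/eqP; [left|right]; right.
    by exists alpha, la, eta, mu, nu.
  exists la, eta, mu, nu; split=> // i.
  (* Converse direction: the two blocks of [alpha] are merged into one disjunction at [i]. *)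
  move/(I00_disjunctionP.2 (ex_intro _ alpha (conj Pf Pt))).
  by case=> [[?|->]|[?|->]]; rewrite ?mul0r ?mulr0; [left|right|left|right].
- move=> alpha [la [eta [mu [nu [W Pf Pt]]]]]; exists la, eta, mu, nu.
  (* The conditions on the block [alpha = 0] coincide; on the other block, both alternatives give
     [0 <= nu 0 i]. *)
  by split=> // i /Pt[[]|->].
- split=> [[la [eta [mu [nu [W]]]]]|[alpha [la [eta [mu [nu [W Af At]]]]]]].
    by move=> /I00_disjunctionP[alpha [Af At]]; exists alpha, la, eta, mu, nu.
  exists la, eta, mu, nu; split=> //.
  by apply/I00_disjunctionP; exists alpha.
- split=> [[la [eta [mu [nu [W C]]]]]|[d [d01 [la [eta [mu [nu [W P]]]]]]]].
    (* The sign flip turns the MPVC condition into the hypothesis of [mulr_ge0_weight] with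
       [b = - nu 0 i], whence the denominator [mu 0 i - nu 0 i] below. *)
    have {}C i : i \in I00 G H x -> 0 <= mu 0 i * - nu 0 i.
      by move=> /C; rewrite mulrN oppr_ge0.
    exists (\row_i if i \in I00 G H x then mu 0 i / (mu 0 i - nu 0 i) else 0).
    split=> [i|].
      rewrite mxE; case: ifP => [/C/mulr_ge0_weight[]//|_].
      by rewrite lexx ler01.
    exists la, eta, mu, nu; split=> // i i00; right.
    by rewrite mxE i00 mulNr -mulrN; have [] := mulr_ge0_weight (C i i00).
  exists la, eta, mu, nu; split=> // i /P[[-> _]|]; first by rewrite mul0r.
  by rewrite mulNr -mulrN => /(weight_mulr_ge0 (d01 i)); rewrite mulrN oppr_ge0.
- split=> [[la [eta [mu [nu [W M]]]]]|[alpha [la [eta [mu [nu [W Pf Pt]]]]]]].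
    have /I00_disjunctionP[alpha [Pf Pt]] : forall i, i \in I00 G H x ->
        mu 0 i = 0 \/ ((mu 0 i = 0 /\ 0 <= nu 0 i) \/ nu 0 i = 0).
      move=> i /M/eqP; rewrite mulf_eq0.
      by move=> /orP[]/eqP; [left|right; right].
    by exists alpha, la, eta, mu, nu.
  exists la, eta, mu, nu; split=> // i.
  move/(I00_disjunctionP.2 (ex_intro _ alpha (conj Pf Pt))).
  by case=> [->|[[-> _]|->]]; rewrite ?mul0r ?mulr0.
(* For [alpha = 0] the block [alpha = 1] is empty, and on the block [alpha = 0] both notions require
   [mu 0 i = 0]. *)
- split=> -[la [eta [mu [nu [W Qf _]]]]]; exists la, eta, mu, nu;
    by split=> // i; rewrite inE ffunE andbF.
Qed.
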